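(* Let $\epsilon$ be a primitive cube root of unity and let $F=\mathbb{Q}(\epsilon)$ be the third cyclotomic field. Let $\alpha$ be a nonzero cubefree rational integer not equal to one, and let $K=F(\sqrt[3]{\alpha})$ be the corresponding Kummer field. Let $p$ be an odd positive prime with $p\equiv 3\pmod 8$. Then the quaternion algebra $H_K(p,2)$ is a division algebra if and only if $\left(\frac{-3}{p}\right)=1$.
   Context: For a field $F$ of characteristic $\neq 2$ and $a,b\in F\setminus\{0\}$, $H_F(a,b)$ denotes the generalized quaternion algebra over $F$ with basis $1,i,j,k$ and relations $i^2=a$, $j^2=b$, $ij=-ji=k$. $\left(\frac{m}{\ell}\right)$ is the Legendre symbol for an odd prime $\ell$, equal to $0$ if $\ell\mid m$. *)

(* Defs.v *)
From HB Require Import structures.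
From mathcomp Require Import all_boot all_order all_algebra all_field.
From mathcomp Require Import ring.
Set Implicit Arguments.
Unset Strict Implicit.
Unset Printing Implicit Defensive.
Import GRing.Theory.
Local Open Scope ring_scope.

(* The quaternion algebra H_F(a, b): [Quat x y z t] stands for
   x + y i + z j + t k, with i^2 = a, j^2 = b and ij = -ji = k.
   The construction makes sense for all F, a and b; H_F(a, b) is called a
   quaternion algebra when F has characteristic <> 2 and a, b are nonzero. *)
Record quaternion (F : fieldType) (a b : F) : Type := Quat {
  quat_1 : F; quat_i : F; quat_j : F; quat_k : F }.

Section Quaternion.
Variables (F : fieldType) (a b : F).
Local Notation H := (quaternion a b).
Local Notation Q := (@Quat F a b).

Definition tuple_of_quat (u : H) : F * F * F * F :=
  (quat_1 u, quat_i u, quat_j u, quat_k u).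
Definition quat_of_tuple (v : F * F * F * F) : H :=
  let: (x, y, z, t) := v in Quat a b x y z t.

Lemma tuple_of_quatK : cancel tuple_of_quat quat_of_tuple.
Proof. by case. Qed.

HB.instance Definition _ := Choice.copy H (can_type tuple_of_quatK).

Definition quat_add (u v : H) : H :=
  Q (quat_1 u + quat_1 v) (quat_i u + quat_i v)
    (quat_j u + quat_j v) (quat_k u + quat_k v).
Definition quat_opp (u : H) : H :=
  Q (- quat_1 u) (- quat_i u) (- quat_j u) (- quat_k u).
Definition quat_scale (c : F) (u : H) : H :=
  Q (c * quat_1 u) (c * quat_i u) (c * quat_j u) (c * quat_k u).
Definition quat_mul (u v : H) : H :=
  let: Quat x y z t := u in
  let: Quat x' y' z' t' := v in
  Q (x * x' + a * y * y' + b * z * z' - a * b * t * t')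
    (x * y' + y * x' - b * z * t' + b * t * z')
    (x * z' + z * x' + a * y * t' - a * t * y')
    (x * t' + t * x' + y * z' - z * y').

Fact quat_addA : associative quat_add.
Proof. by move=> [????] [????] [????]; congr Quat; rewrite /= addrA. Qed.
Fact quat_addC : commutative quat_add.
Proof. by move=> [????] [????]; congr Quat; rewrite /= addrC. Qed.
Fact quat_add0 : left_id (Q 0 0 0 0) quat_add.
Proof. by move=> [????]; congr Quat; rewrite /= add0r. Qed.
Fact quat_addN : left_inverse (Q 0 0 0 0) quat_opp quat_add.
Proof. by move=> [????]; congr Quat; rewrite /= addNr. Qed.

HB.instance Definition _ :=
  GRing.isZmodule.Build H quat_addA quat_addC quat_add0 quat_addN.

Fact quat_mulA : associative quat_mul.
Proof. by move=> [????] [????] [????]; congr Quat; ring. Qed.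
Fact quat_mul1 : left_id (Q 1 0 0 0) quat_mul.
Proof. by move=> [????]; congr Quat; ring. Qed.
Fact quat_mulr1 : right_id (Q 1 0 0 0) quat_mul.
Proof. by move=> [????]; congr Quat; ring. Qed.
Fact quat_mulDl : left_distributive quat_mul +%R.
Proof. by move=> [????] [????] [????]; congr Quat => /=; ring. Qed.
Fact quat_mulDr : right_distributive quat_mul +%R.
Proof. by move=> [????] [????] [????]; congr Quat => /=; ring. Qed.
Fact quat_1_neq0 : Q 1 0 0 0 != 0.
Proof. by apply/eqP => -[] /eqP; rewrite oner_eq0. Qed.

HB.instance Definition _ := GRing.Zmodule_isNzRing.Build H
  quat_mulA quat_mul1 quat_mulr1 quat_mulDl quat_mulDr quat_1_neq0.

Fact quat_scaleA c d (u : H) :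
  quat_scale c (quat_scale d u) = quat_scale (c * d) u.
Proof. by case: u => *; congr Quat; rewrite /= mulrA. Qed.
Fact quat_scale1 : left_id 1 quat_scale.
Proof. by move=> [????]; congr Quat; rewrite /= mul1r. Qed.
Fact quat_scaleDr : right_distributive quat_scale +%R.
Proof. by move=> c [????] [????]; congr Quat; rewrite /= mulrDr. Qed.
Fact quat_scaleDl (u : H) : {morph quat_scale^~ u : c d / c + d}.
Proof. by move=> c d; case: u => *; congr Quat; rewrite /= mulrDl. Qed.

HB.instance Definition _ := GRing.Zmodule_isLmodule.Build F H
  quat_scaleA quat_scale1 quat_scaleDr quat_scaleDl.

Fact quat_scaleAl (c : F) (u v : H) : c *: (u * v) = c *: u * v.
Proof. by case: u v => [????] [????]; congr Quat => /=; ring. Qed.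
HB.instance Definition _ := GRing.Lmodule_isLalgebra.Build F H quat_scaleAl.

Fact quat_scaleAr (c : F) (u v : H) : c *: (u * v) = u * (c *: v).
Proof. by case: u v => [????] [????]; congr Quat => /=; ring. Qed.
HB.instance Definition _ := GRing.Lalgebra_isAlgebra.Build F H quat_scaleAr.

Definition qi : H := Q 0 1 0 0.
Definition qj : H := Q 0 0 1 0.
Definition qk : H := Q 0 0 0 1.

Lemma qi_sqr : qi ^+ 2 = a%:A.
Proof. by congr Quat => /=; ring. Qed.
Lemma qj_sqr : qj ^+ 2 = b%:A.
Proof. by congr Quat => /=; ring. Qed.
Lemma qij : qi * qj = qk.
Proof. by congr Quat => /=; ring. Qed.
Lemma qji : qj * qi = - qk.
Proof. by congr Quat => /=; ring. Qed.
Lemma quat_basis x y z t :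
  Q x y z t = x *: 1 + y *: qi + z *: qj + t *: qk.
Proof. by congr Quat => /=; ring. Qed.

End Quaternion.

Definition is_division_algebra (F : fieldType) (A : algType F) : Prop :=
  forall x : A, x != 0 -> exists y : A, x * y = 1 /\ y * x = 1.

Definition cubefree (m : int) : Prop :=
  forall q : nat, prime q -> ~~ ((q%:Z ^+ 3) %| m)%Z.

Definition legendre (m : int) (l : nat) : int :=
  if (l%:Z %| m)%Z then 0
  else if [exists x : 'I_l, ((x%:Z ^+ 2)%R == m %[mod l%:Z])%Z] then 1 else -1.

(* Main.v *)
(** H_K(p,2) is a division algebra iff its norm form
    x^2 - p y^2 - 2 z^2 + 2 p t^2 is anisotropic over K.  An anisotropic form
    over F stays anisotropic over the (at most) cubic extension K, as in
    Springer's theorem: if a cubic irreducible f divides the value of the form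
    at polynomials of degree at most 2, the cofactor is linear and has a root,
    which can be divided out, leaving a value of degree 2 < 3.

    Over F = Q(s) with s^2 = -3: if -3 is a nonzero square mod p, the two maps
    Z[s] -> F_p sending s to a square root r or to -r show, 2 being a
    nonresidue, that x^2 - 2 z^2 = p (y^2 - 2 t^2) forces p | x and p | z in
    Z[s], which yields an infinite descent.  Otherwise -6 is a square mod p,
    and Thue's lemma gives X^2 + 6 Y^2 = k p with 0 < k < 7.  The left-hand
    side is X^2 - 2 (s Y)^2, and each such k has the form y^2 - 2 t^2 in F, so
    the norm form is isotropic. *)

Require Import Defs.
From mathcomp Require Import all_boot all_order all_algebra all_field.
From mathcomp Require Import fingroup cyclic.
From mathcomp Require Import ring zify.
Import Order.TTheory GRing.Theory Num.Theory.
Local Open Scope ring_scope.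

(** * Quaternion algebras and their norm forms *)

Definition quat_norm {R : comNzRingType} (a b x y z t : R) : R :=
  x ^+ 2 - a * y ^+ 2 - b * z ^+ 2 + a * b * t ^+ 2.

(** The predicate [S] lets one notion serve both a whole field and a subfield of [L]. *)
Definition anisotropic {R : comNzRingType} (S : {pred R}) (a b : R) : Prop :=
  forall x y z t, x \in S -> y \in S -> z \in S -> t \in S ->
  quat_norm a b x y z t = 0 -> [/\ x = 0, y = 0, z = 0 & t = 0].

Lemma rmorph_quat_norm (R S : comNzRingType) (f : {rmorphism R -> S})
    (a b x y z t : R) :
  f (quat_norm a b x y z t) =
  quat_norm (f a) (f b) (f x) (f y) (f z) (f t).
Proof. by rewrite /quat_norm rmorphD !rmorphB !(rmorphM, rmorphXn). Qed.

(** Both [u * conj u] and [conj u * u] are the scalar [N u]. A nonzero norm thus gives the inverse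
    [(N u)^-1 *: conj u]; if [N u = 0] and [v * u = 1], then [conj u = v * (u * conj u) = 0]. *)
Lemma division_quaternionP (F : fieldType) (a b : F) :
  is_division_algebra (quaternion a b) <-> anisotropic predT a b.
Proof.
pose conj (u : quaternion a b) :=
  Quat a b (quat_1 u) (- quat_i u) (- quat_j u) (- quat_k u).
pose N (u : quaternion a b) :=
  quat_norm a b (quat_1 u) (quat_i u) (quat_j u) (quat_k u).
have conjr u : u * conj u = (N u)%:A.
  by case: u => x y z t; congr Quat; rewrite /N /quat_norm /=; ring.
have conjl u : conj u * u = (N u)%:A.
  by case: u => x y z t; congr Quat; rewrite /N /quat_norm /=; ring.
split=> [div x y z t _ _ _ _ Nu0|aniso u u_neq0].
  pose u := Quat a b x y z t.
  have [u0|/div[v [_ vu]]] := eqVneq u 0; first by case: u0.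
  have : conj u = 0.
    by rewrite -[conj u]mul1r -vu -mulrA conjr /N /= Nu0 scale0r mulr0.
  by case=> -> /eqP + /eqP + /eqP; rewrite !oppr_eq0 => /eqP-> /eqP-> /eqP->.
have Nu_neq0 : N u != 0.
  apply: contraNneq u_neq0; case: u => x y z t /= Nu0.
  by have [] // := aniso x y z t _ _ _ _ Nu0; move=> -> -> -> ->.
exists ((N u)^-1 *: conj u).
by rewrite -scalerAr -scalerAl conjl conjr scalerA mulVf // scale1r.
Qed.

Lemma anisotropic_subvs (F0 : fieldType) (L : fieldExtType F0)
    (K : {subfield L}) (a b : subvs_of K) :
  anisotropic predT a b <-> anisotropic K (val a) (val b).
Proof.
split=> aniso x y z t; last first.
  move=> _ _ _ _ /(congr1 val); rewrite [LHS](rmorph_quat_norm _ _ vsval) => q0.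
  have [|||||x0 y0 z0 t0] := aniso (val x) (val y) (val z) (val t);
    rewrite ?subvsP //.
  by split; apply: val_inj.
move=> Kx Ky Kz Kt q0.
have q1 : quat_norm a b (Subvs Kx) (Subvs Ky) (Subvs Kz) (Subvs Kt) = 0.
  by apply: val_inj; rewrite [LHS](rmorph_quat_norm _ _ vsval).
have [] := aniso _ _ _ _ isT isT isT isT q1.
by do 4 move=> /(congr1 val) /= ->.
Qed.

(** * Anisotropic forms under cubic extensions *)

Lemma coef_mul_top (R : nzRingType) (p q : {poly R}) (m n : nat) :
  (size p <= m.+1)%N -> (size q <= n.+1)%N ->
  (p * q)`_(m + n) = p`_m * q`_n.
Proof.
move=> sp sq; rewrite coefM.
have ltm : (m < (m + n).+1)%N by rewrite ltnS leq_addr.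
rewrite (bigD1 (Ordinal ltm)) //= addKn big1 ?addr0 // => i.
rewrite -val_eqE /= neq_ltn => /orP[lt_im|lt_mi].
  by rewrite [X in _ * X]nth_default ?mulr0 // (leq_trans sq) //; lia.
by rewrite nth_default ?mul0r // (leq_trans sp).
Qed.

Lemma size_quat_norm (F : fieldType) (a b : F) (x y z t : {poly F}) (m : nat) :
  (size x <= m.+1)%N -> (size y <= m.+1)%N ->
  (size z <= m.+1)%N -> (size t <= m.+1)%N ->
  (size (quat_norm a%:P b%:P x y z t) <= (m + m).+1)%N.
Proof.
have sqr_size (c : F) (u : {poly F}) :
    (size u <= m.+1)%N -> (size (c%:P * u ^+ 2)%R <= (m + m).+1)%N.
  move=> su; rewrite mul_polyC (leq_trans (size_scale_leq _ _)) //.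
  by rewrite expr2 (leq_trans (size_polyMleq _ _)) //; lia.
move=> sx sy sz st; rewrite /quat_norm -polyCM -[x ^+ 2]mul1r -[1]/(1%:P).
do 3 rewrite (leq_trans (size_polyD _ _)) // geq_max ?size_polyN ?sqr_size //.
Qed.

(** The coefficient of degree [m + m] of the value is the form evaluated at the coefficients of
    degree [m]; when it vanishes, anisotropy kills these four coefficients. *)
Lemma anisotropic_size (F : fieldType) (a b : F) (x y z t : {poly F})
    (m : nat) :
  anisotropic predT a b ->
  (size x <= m.+1)%N -> (size y <= m.+1)%N ->
  (size z <= m.+1)%N -> (size t <= m.+1)%N ->
  (size (quat_norm a%:P b%:P x y z t) <= m + m)%N ->
  [/\ (size x <= m)%N, (size y <= m)%N, (size z <= m)%N & (size t <= m)%N].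
Proof.
move=> aniso sx sy sz st sN.
have [] := aniso x`_m y`_m z`_m t`_m isT isT isT isT.
  have := nth_default 0 sN; rewrite /quat_norm -polyCM !mul_polyC.
  by rewrite !(coefD, coefN, coefZ) !expr2 !coef_mul_top.
have shrink (u : {poly F}) : (size u <= m.+1)%N -> u`_m = 0 -> (size u <= m)%N.
  move=> su um; apply/leq_sizeP => j; rewrite leq_eqVlt => /predU1P[<- //|ltmj].
  by rewrite nth_default // (leq_trans su).
by split; apply: shrink.
Qed.

(** The value has degree at most 2, below that of [f], so it is zero; comparing top coefficients
    twice then kills the four polynomials. *)
Lemma anisotropic_poly_linear (F : fieldType) (a b : F)
    (f x y z t : {poly F}) :
  anisotropic predT a b -> size f = 4%N ->
  (size x <= 2)%N -> (size y <= 2)%N -> (size z <= 2)%N -> (size t <= 2)%N ->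
  f %| quat_norm a%:P b%:P x y z t -> [/\ x = 0, y = 0, z = 0 & t = 0].
Proof.
move=> aniso sf sx sy sz st dvdf.
have N0 : quat_norm a%:P b%:P x y z t = 0.
  apply/eqP; apply: contraLR dvdf => N_neq0; apply/negP => /dvdp_leq.
  move=> /(_ N_neq0); rewrite sf leqNgt => /negP; apply; rewrite ltnS.
  exact: (@size_quat_norm _ _ _ _ _ _ _ 1).
have [||||| x1 y1 z1 t1] := @anisotropic_size _ a b x y z t 1 aniso.
  1-5: by rewrite ?N0 ?size_poly0.
have [||||| x0 y0 z0 t0] := @anisotropic_size _ a b x y z t 0 aniso.
  1-5: by rewrite ?N0 ?size_poly0.
by split; apply/eqP; rewrite -size_poly_leq0.
Qed.

Lemma anisotropic_poly_quadratic (F : fieldType) (a b : F)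
    (f x y z t : {poly F}) :
  anisotropic predT a b -> irreducible_poly f -> size f = 4%N ->
  (size x <= 3)%N -> (size y <= 3)%N -> (size z <= 3)%N -> (size t <= 3)%N ->
  f %| quat_norm a%:P b%:P x y z t -> [/\ x = 0, y = 0, z = 0 & t = 0].
Proof.
move=> aniso irrf sf sx sy sz st dvdf.
set N := quat_norm a%:P b%:P x y z t in dvdf.
(* A value of degree at most 3 has no term of degree 4, so the arguments are in fact linear.
   Otherwise the degree is 4 and the cofactor [g] is linear. *)
have [sN|sN] := leqP (size N) 4.
  have [||||| sx' sy' sz' st'] := @anisotropic_size _ a b x y z t 2 aniso => //.
  exact: (@anisotropic_poly_linear _ a b f).
have /dvdpP[g defN] := dvdf.
have N_neq0 : N != 0 by rewrite -size_poly_gt0 (leq_trans _ sN).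
have g_neq0 : g != 0 by apply: contraNneq N_neq0 => g0; rewrite defN g0 mul0r.
have sg : size g = 2%N.
  have : (size N <= 5)%N by apply: (@size_quat_norm _ _ _ _ _ _ _ 2).
  move: sN; rewrite defN size_mul ?(irredp_neq0 irrf) // sf.
  by move: (size _) => k; clear; lia.
have [r rootg] : exists r, root g r.
  by have [r] := poly2_root sg; exists r.
have rootN : N.[r] = 0 by rewrite defN hornerM (eqP rootg) mul0r.
have [] := aniso x.[r] y.[r] z.[r] t.[r] isT isT isT isT.
  rewrite -rootN /N /quat_norm.
  by rewrite !(hornerD, hornerN, hornerM, hornerC, hornerXn).
move=> /eqP/factor_theorem[x' defx] /eqP/factor_theorem[y' defy].
move=> /eqP/factor_theorem[z' defz] /eqP/factor_theorem[t' deft].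
have size_quotient (u : {poly F}) :
    (size (u * ('X - r%:P))%R <= 3)%N -> (size u <= 2)%N.
  have [->|u_neq0] := eqVneq u 0; first by rewrite size_poly0.
  by rewrite size_Mmonic ?monicXsubC // size_XsubC addn2.
rewrite {}/N in dvdf sN defN N_neq0 rootN.
rewrite {sN defN N_neq0 rootN}defx {}defy {}defz {}deft in sx sy sz st dvdf *.
(* Being irreducible of degree 3, [f] has no factor ['X - r%:P], so it still divides the value once
   [('X - r%:P) ^+ 2] is divided out. *)
have copf : coprimep f (('X - r%:P) ^+ 2).
  rewrite coprimep_expr // coprimep_XsubC.
  rewrite -dvdp_XsubCl; apply/negP => /irrf.2; rewrite size_XsubC.
  by move=> /(_ isT) /eqp_size; rewrite size_XsubC sf.
have [||||| -> -> -> ->] :=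
    @anisotropic_poly_linear _ a b f x' y' z' t' aniso sf;
  rewrite ?mul0r ?size_quotient //.
rewrite -(Gauss_dvdpr _ copf); congr (is_true (f %| _)): dvdf.
by rewrite /quat_norm; ring.
Qed.

(** Elements of F(theta) are values at [theta] of polynomials over F of degree at most 2. A zero of
    the form lifts to such polynomials, where the form takes a value divisible by ['X^3 - c%:P], a
    cubic without root in F and hence irreducible. *)
Lemma anisotropic_adjoin_cube_root (F0 : fieldType) (L : fieldExtType F0)
    (F : {subfield L}) (theta : L) (a b : subvs_of F) :
  theta ^+ 3 \in F -> (forall r, r \in F -> r ^+ 3 != theta ^+ 3) ->
  anisotropic F (val a) (val b) -> anisotropic <<F; theta>>%VS (val a) (val b).
Proof.
move=> F_theta3 no_root /anisotropic_subvs aniso.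
pose c := Subvs F_theta3; pose f : {poly subvs_of F} := 'X^3 - c%:P.
have sf : size f = 4%N by rewrite size_XnsubC.
have irrf : irreducible_poly f.
  apply: cubic_irreducible => [|r]; first by rewrite sf.
  rewrite rootE !hornerE subr_eq0; apply: contra (no_root _ (subvsP r)).
  by move=> /eqP /(congr1 val) /= <-; rewrite -rmorphXn.
have fE : map_poly vsval f = 'X^3 - (theta ^+ 3)%:P.
  by rewrite rmorphB /= map_polyXn map_polyC.
have f_theta : (map_poly vsval f).[theta] = 0 by rewrite fE !hornerE subrr.
pose ev (q : {poly subvs_of F}) := (map_poly vsval q).[theta].
have ev_mod q : ev q = ev (q %% f).
  rewrite /ev {1}(divp_eq q f) rmorphD rmorphM hornerD hornerM.
  by rewrite f_theta mulr0 add0r.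
(* If the irreducible [f] does not divide [q], the two are coprime and cannot share the root
   [theta]. *)
have dvd_ev q : ev q = 0 -> f %| q.
  apply: contra_eqT => ndvd.
  have := ndvd; rewrite -(irreducible_poly_coprime _ irrf).
  rewrite -(coprimep_map vsval) => /coprimep_root; apply.
  by rewrite rootE f_theta.
have repr v : v \in <<F; theta>>%VS ->
    exists2 q : {poly subvs_of F}, (size q <= 3)%N & ev q = v.
  case/Fadjoin_polyP => _ /polyOver_subvs[q ->] ->; exists (q %% f).
    by have := ltn_modpN0 q (irredp_neq0 irrf); rewrite sf.
  by rewrite -ev_mod.
move=> _ _ _ _ /repr[x sx <-] /repr[y sy <-] /repr[z sz <-] /repr[t st <-] N0.
have [|||||-> -> -> ->] :=
  @anisotropic_poly_quadratic _ a b f x y z t aniso irrf sf => //; last first.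
  by rewrite /ev rmorph0 horner0.
apply: dvd_ev; rewrite -N0 /ev rmorph_quat_norm. rewrite /= !map_polyC /=.
by rewrite /quat_norm !(hornerD, hornerN, hornerM, hornerC).
Qed.

(** * Thue's lemma and quadratic residues modulo p *)

Lemma prime_sqrt (p : nat) : prime p ->
  exists m : nat, (m ^ 2 < p < m.+1 ^ 2)%N.
Proof.
move=> p_pr; have nsq m : (m ^ 2 != p)%N.
  apply: contraTneq p_pr => <-; case: m => [|[|m]] //.
  by apply/primePn; right; exists m.+2; rewrite ?dvdn_mulr //; lia.
have ex0 : exists m, (p < m.+1 ^ 2)%N by exists p; nia.
case: (ex_minnP ex0) => m lt_p min_m; exists m; rewrite lt_p andbT.
rewrite ltn_neqAle nsq; case: m min_m {lt_p} => // m min_m.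
by rewrite leqNgt; apply/negP => /min_m; rewrite ltnn.
Qed.

(** Pigeonhole: with m the integer square root of p, there are (m + 1)^2 > p pairs in [0, m]^2, so
    two of them have the same [g]. Their difference has entries of absolute value at most m, and m^2
    < p. *)
Lemma thue (p : nat) (r : 'F_p) : prime p ->
  exists x y : int, [/\ (x != 0) || (y != 0), x ^+ 2 < p%:Z, y ^+ 2 < p%:Z
                      & x%:~R = r * y%:~R].
Proof.
move=> p_pr; have [m /andP[lt_mp lt_pm]] := prime_sqrt p p_pr.
pose g (u : 'I_m.+1 * 'I_m.+1) : 'F_p := (u.1 : nat)%:R - r * (u.2 : nat)%:R.
have /injectivePn[[a b] [[c d] neq eq_g]] : ~~ injectiveb g.
  apply: contraL lt_pm => /injectiveP /leq_card.
  by rewrite card_prod !card_ord (Fp_cast p_pr) -leqNgt mulnn.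
have sqr_bound (i j : 'I_m.+1) : (i%:Z - j%:Z) ^+ 2 < p%:Z.
  have := ltn_ord i; have := ltn_ord j; move: lt_mp.
  by move: (nat_of_ord i) (nat_of_ord j) => {}i {}j; clear; nia.
exists (a%:Z - c%:Z), (b%:Z - d%:Z); split=> //.
  rewrite !subr_eq0 !eqz_nat -negb_and; apply: contra neq => /andP[ac bd].
  by rewrite xpair_eqE -!val_eqE ac.
by move: eq_g; rewrite /g /= !rmorphB /= => /eqP; rewrite subr_eq => /eqP e;
   rewrite -!pmulrn e; ring.
Qed.

Lemma intr_Fp_eq0 (p : nat) (n : int) : prime p ->
  (n%:~R == 0 :> 'F_p) = (p%:Z %| n)%Z.
Proof. by move=> p_pr; rewrite (dvdz_pcharf (pchar_Fp p_pr)). Qed.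

Lemma thue_form (p : nat) (r : 'F_p) (d : int) : prime p -> r ^+ 2 = d%:~R ->
  exists x y k : int, [/\ (x != 0) || (y != 0), x ^+ 2 < p%:Z, y ^+ 2 < p%:Z
                        & x ^+ 2 - d * y ^+ 2 = k * p%:Z].
Proof.
move=> p_pr r2; have [x [y [xy0 x_lt y_lt xry]]] := thue p r p_pr.
have /dvdzP[k kp] : (p%:Z %| x ^+ 2 - d * y ^+ 2)%Z.
  rewrite -intr_Fp_eq0 // rmorphB !(rmorphXn, rmorphM) /= xry -r2.
  by apply/eqP; ring.
by exists x, y, k.
Qed.

(** The exponent of 2 is even in a nonzero square and odd in twice a nonzero square. *)
Lemma sqr2_neq (x y : int) : (x != 0) || (y != 0) -> x ^+ 2 != 2 * y ^+ 2.
Proof.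
move=> xy0; apply/eqP => e.
have {}e : (`|x| ^ 2 = 2 * `|y| ^ 2)%N.
  by move/(congr1 absz): e; rewrite abszM !abszX.
have y0 : (0 < `|y|)%N.
  rewrite absz_gt0; apply: contraTneq xy0 => y0.
  move: e; rewrite y0 eqxx orbF negbK muln0 => /eqP.
  by rewrite expn_eq0 absz_eq0 andbT.
have := congr1 (logn 2) e.
by rewrite lognM ?expn_gt0 ?y0 // !lognX (pfactorK 1 (isT : prime 2)); lia.
Qed.

Lemma two_nonresidue (p : nat) (r : 'F_p) :
  prime p -> p = 3 %[mod 8] -> r ^+ 2 != 2%:R.
Proof.
move=> p_pr p3; apply/eqP => r2.
have [x [y [k [xy0 x_lt y_lt]]]] := thue_form p r 2 p_pr r2.
have := sqr2_neq x y xy0; set X := x ^+ 2 in x_lt * => neq e.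
have Xge0 : 0 <= X by apply: sqr_ge0.
have Yge0 : 0 <= y ^+ 2 by apply: sqr_ge0.
(* Both squares lie in [0, p), so x^2 - 2 y^2 lies strictly between -2p and p; it is nonzero because
   2 is not a rational square. *)
have km1 : k = -1.
  move: (y ^+ 2) Yge0 y_lt neq e => Y Yge0 y_lt neq e.
  have [k_le|[//|[k0|k_ge]]] : k <= - 2 \/ k = - 1 \/ k = 0 \/ 1 <= k by lia.
  - have := @ler_wpM2r _ p%:Z isT _ _ k_le; lia.
  - by move: e; rewrite k0; lia.
  - have := @ler_wpM2r _ p%:Z isT _ _ k_ge; lia.
(* Now x^2 - 2 y^2 = -p is 5 modulo 8. But x must be odd, so x^2 is 1 modulo 8, and x^2 - 2 y^2 is 1
   or -1 according to the parity of y. *)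
have [j pj] : exists j : nat, p = (8 * j + 3)%N by exists (p %/ 8)%N; lia.
have [u [xu|xu]] : exists u : int, x = 2 * u \/ x = 2 * u + 1.
- by exists (x %/ 2)%Z; lia.
- by move: e; rewrite /X xu km1 pj; nia.
have [v [yv|yv]] : exists v : int, y = 2 * v \/ y = 2 * v + 1.
  by exists (y %/ 2)%Z; lia.
- have [w uw] : exists w : int, u * (u + 1) = 2 * w.
    exists ((u * (u + 1)) %/ 2)%Z.
    have [u' [->|->]] : exists v : int, u = 2 * v \/ u = 2 * v + 1.
      by exists (u %/ 2)%Z; lia.
    + by nia.
    + by nia.
  by move: e; rewrite /X xu yv km1 pj; nia.
- by move: e; rewrite /X xu yv km1 pj; nia.
Qed.

(** The unit group of ['F_p] is cyclic and nonresidues are odd powers of a generator, so the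
    exponents add up to an even number. *)
Lemma mul_nonresidues (p : nat) (a b : 'F_p) : prime p ->
  (forall r, r ^+ 2 != a) -> (forall r, r ^+ 2 != b) ->
  exists r, r ^+ 2 = a * b.
Proof.
move=> p_pr na nb.
have unit_neq0 (c : 'F_p) : (forall r, r ^+ 2 != c) -> c \is a GRing.unit.
  by move=> nc; have := nc 0; rewrite expr0n unitfE eq_sym.
pose ua := FinRing.unit 'F_p (unit_neq0 a na).
pose ub := FinRing.unit 'F_p (unit_neq0 b nb).
have /cyclicP[g gP] := cyclic.field_unit_group_cyclic [set: {unit 'F_p}]%G.
have /cycleP[i ui] : ua \in <[g]>%g by rewrite -gP inE.
have /cycleP[j uj] : ub \in <[g]>%g by rewrite -gP inE.
have {ui} ai : a = FinRing.uval g ^+ i.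
  by have := congr1 FinRing.uval ui; rewrite FinRing.val_unitX.
have {uj} bj : b = FinRing.uval g ^+ j.
  by have := congr1 FinRing.uval uj; rewrite FinRing.val_unitX.
have nonres_odd (c : 'F_p) k : (forall r, r ^+ 2 != c) ->
    c = FinRing.uval g ^+ k -> odd k.
  move=> nc ck; apply: contraT => even_k.
  have := nc (FinRing.uval g ^+ k./2).
  by rewrite -exprM muln2 even_halfK // ck eqxx.
exists (FinRing.uval g ^+ (i + j)./2).
rewrite -exprM muln2 even_halfK; first by rewrite exprD -ai -bj.
by rewrite oddD (nonres_odd _ _ na ai) (nonres_odd _ _ nb bj).
Qed.

Lemma nonresidue_eq0 (F : fieldType) (c u w : F) :
  (forall r, r ^+ 2 != c) -> u ^+ 2 = c * w ^+ 2 -> u = 0 /\ w = 0.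
Proof.
move=> nres uw; have [w0|w_neq0] := eqVneq w 0.
  by move/eqP: uw; rewrite w0 expr0n mulr0 expf_eq0 => /eqP.
have /eqP[] := nres (u / w).
by rewrite expr_div_n uw mulfK // expf_neq0.
Qed.

(** The two equations are the coordinates of x^2 = c z^2 for x = x0 + x1 s and z = z0 + z1 s with
    s^2 = r^2. Sending s to r and to -r gives (x0 ± r x1)^2 = c (z0 ± r z1)^2, where both sides must
    vanish. *)
Lemma nonresidue_split_eq0 (F : fieldType) (c r x0 x1 z0 z1 : F) :
  2%:R != 0 :> F -> r != 0 -> (forall u, u ^+ 2 != c) ->
  x0 ^+ 2 + r ^+ 2 * x1 ^+ 2 = c * (z0 ^+ 2 + r ^+ 2 * z1 ^+ 2) ->
  x0 * x1 = c * (z0 * z1) -> [/\ x0 = 0, x1 = 0, z0 = 0 & z1 = 0].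
Proof.
move=> two_neq0 r_neq0 nres e0 e1.
have half (a b : F) : a + r * b = 0 -> a - r * b = 0 -> a = 0 /\ b = 0.
  move=> ab0 ab1; have a0 : a = 0.
    apply: (mulfI two_neq0).
    transitivity ((a + r * b) + (a - r * b)); first by ring.
    by rewrite ab0 ab1; ring.
  move: ab0; rewrite a0 add0r => /eqP.
  by rewrite mulf_eq0 (negPf r_neq0) => /eqP.
have [x_p z_p] : x0 + r * x1 = 0 /\ z0 + r * z1 = 0.
  apply: (nonresidue_eq0 _ c) nres _.
  transitivity (x0 ^+ 2 + r ^+ 2 * x1 ^+ 2 + 2%:R * r * (x0 * x1)).
    by ring.
  by rewrite e0 e1; ring.
have [x_m z_m] : x0 - r * x1 = 0 /\ z0 - r * z1 = 0.
  apply: (nonresidue_eq0 _ c) nres _.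
  transitivity (x0 ^+ 2 + r ^+ 2 * x1 ^+ 2 - 2%:R * r * (x0 * x1)).
    by ring.
  by rewrite e0 e1; ring.
by have [-> ->] := half _ _ x_p x_m; have [-> ->] := half _ _ z_p z_m.
Qed.

(** * Descent in Z[s] and in Q(s), where s^2 = -3 *)

Lemma intr_rat_ext_eq0 (L : fieldExtType rat) (n : int) :
  (n%:~R == 0 :> L) = (n == 0).
Proof. by rewrite -(rmorph_int (in_alg L)) fmorph_eq0 intr_eq0. Qed.

(** For s^2 = -3 this is the order Z[s], of index 2 in the Eisenstein integers. *)
Definition int_span {R : nzRingType} (s x : R) : Prop :=
  exists a b : int, x = a%:~R + b%:~R * s.

Section SqrtMinusThree.
Variables (L : fieldExtType rat) (s : L).
Hypothesis s2 : s ^+ 2 = - 3%:R.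

(** If u + v s = 0, multiplying by u - v s gives u^2 + 3 v^2 = 0. This turns equations in Z[s] into
    pairs of integer equations. *)
Lemma int_span_inj (a b c d : int) :
  a%:~R + b%:~R * s = c%:~R + d%:~R * s -> a = c /\ b = d.
Proof.
move=> e; pose u := a - c; pose v := b - d.
have uv0 : u%:~R + v%:~R * s = 0.
  by rewrite /u /v !rmorphB /= -(subrr (a%:~R + b%:~R * s)) {2}e; ring.
have : (u ^+ 2 + 3 * v ^+ 2)%:~R == 0 :> L.
  rewrite rmorphD !(rmorphXn, rmorphM) /=; apply/eqP.
  transitivity ((u%:~R + v%:~R * s) * (u%:~R - v%:~R * s)); last first.
    by rewrite uv0 mul0r.
  transitivity (u%:~R ^+ 2 - v%:~R ^+ 2 * s ^+ 2); last by ring.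
  by rewrite s2; ring.
rewrite intr_rat_ext_eq0 => /eqP uv.
have [u0 v0] : u = 0 /\ v = 0.
  have := sqr_ge0 u; have := sqr_ge0 v => v2 u2.
  have /eqP : u ^+ 2 = 0 by lia.
  have /eqP : v ^+ 2 = 0 by lia.
  by rewrite !sqrf_eq0 => /eqP-> /eqP->.
by move: u0 v0; rewrite /u /v; lia.
Qed.

Lemma int_spanD (x y : L) : int_span s x -> int_span s y -> int_span s (x + y).
Proof.
move=> [a [b ->]] [c [d ->]]; exists (a + c), (b + d).
by rewrite !rmorphD /=; ring.
Qed.

Lemma int_spanM (x y : L) : int_span s x -> int_span s y -> int_span s (x * y).
Proof.
move=> [a [b ->]] [c [d ->]]; exists (a * c - 3 * (b * d)), (a * d + b * c).
rewrite rmorphB rmorphD !rmorphM /=.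
transitivity (a%:~R * c%:~R + b%:~R * d%:~R * s ^+ 2 +
              (a%:~R * d%:~R + b%:~R * c%:~R) * s); first by ring.
by rewrite s2; ring.
Qed.

Lemma int_span_int (n : int) : int_span s (n%:~R : L).
Proof. by exists n, 0; rewrite mul0r addr0. Qed.

Lemma int_span_unbounded_dvd (p : nat) (x : L) : (1 < p)%N ->
  int_span s x ->
  (forall m, exists2 x', int_span s x' & x = (p ^ m)%:R * x') -> x = 0.
Proof.
move=> p_gt1 [a [b xab]] dvd_x.
have dvd0 (c : int) : (forall m, (p ^ m)%:Z %| c)%Z -> c = 0.
  (* The exponent [|c|] is large enough, since p^n > n. *)
  move=> /(_ `|c|%N) dvd_c; apply/eqP; rewrite -absz_eq0.
  move: dvd_c; rewrite dvdzE /=; case: (posnP `|c|%N) => [->//|c_gt0].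
  by move=> /(dvdn_leq c_gt0); rewrite leqNgt ltn_expl.
have dvd_ab m : ((p ^ m)%:Z %| a)%Z && ((p ^ m)%:Z %| b)%Z.
  have [_ [a' [b' ->]] e] := dvd_x m.
  have [|-> ->] := @int_span_inj a b ((p ^ m)%:Z * a') ((p ^ m)%:Z * b').
    by rewrite -xab e !rmorphM /=; ring.
  by rewrite !dvdz_mulr.
have a0 : a = 0 by apply: dvd0 => m; case/andP: (dvd_ab m).
have b0 : b = 0 by apply: dvd0 => m; case/andP: (dvd_ab m).
by rewrite xab a0 b0 mul0r addr0.
Qed.

(** The output equation has the same shape with the pairs (x, z) and (y, t) exchanged, so two steps
    divide all four entries by p. *)
Lemma int_span_descent_step (p : nat) (r : 'F_p) (x z y t : L) :
  prime p -> odd p -> r != 0 -> r ^+ 2 = - 3%:R ->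
  (forall u : 'F_p, u ^+ 2 != 2%:R) ->
  int_span s x -> int_span s z -> int_span s y -> int_span s t ->
  x ^+ 2 - 2%:R * z ^+ 2 = p%:R * (y ^+ 2 - 2%:R * t ^+ 2) ->
  exists x' z', [/\ int_span s x', int_span s z', x = p%:R * x', z = p%:R * z' &
    y ^+ 2 - 2%:R * t ^+ 2 = p%:R * (x' ^+ 2 - 2%:R * z' ^+ 2)].
Proof.
move=> p_pr p_odd r_neq0 r2 nres [x0 [x1 xE]] [z0 [z1 zE]] Oy Ot e.
have p_neq0 : p%:R != 0 :> L.
  by rewrite pmulrn intr_rat_ext_eq0 eqz_nat -lt0n prime_gt0.
have [w0 [w1 wE]] : int_span s (y ^+ 2 - 2%:R * t ^+ 2).
  have -> : y ^+ 2 - 2%:R * t ^+ 2 = y * y + (- 2)%:~R * (t * t) by ring.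
  by apply: int_spanD; apply: int_spanM => //;
    [apply: int_span_int | apply: int_spanM].
(* Comparing coordinates in the basis 1, s: both coordinates of x^2 - 2 z^2 are multiples of p. *)
have [e0 e1] :
    x0 ^+ 2 - 3 * x1 ^+ 2 - 2 * (z0 ^+ 2 - 3 * z1 ^+ 2) = p%:Z * w0 /\
    2 * (x0 * x1 - 2 * (z0 * z1)) = p%:Z * w1.
  apply: int_span_inj; rewrite !(rmorphB, rmorphM, rmorphXn) /=.
  transitivity (p%:R * (w0%:~R + w1%:~R * s)); last by ring.
  rewrite -wE -e xE zE.
  transitivity (x0%:~R ^+ 2 + x1%:~R ^+ 2 * s ^+ 2 + 2%:R * x0%:~R * x1%:~R * s
     - 2%:R * (z0%:~R ^+ 2 + z1%:~R ^+ 2 * s ^+ 2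
               + 2%:R * z0%:~R * z1%:~R * s)); last by ring.
  by rewrite s2; ring.
have two_neq0 : 2%:R != 0 :> 'F_p.
  rewrite (intr_Fp_eq0 p 2) // dvdzE /= dvdn_prime2 //.
  by apply: contraTneq p_odd => ->.
have p0 : p%:R = 0 :> 'F_p by apply: pchar_Fp_0.
have [x00 x10 z00 z10] : [/\ x0%:~R = 0 :> 'F_p, x1%:~R = 0 :> 'F_p,
                             z0%:~R = 0 :> 'F_p & z1%:~R = 0 :> 'F_p].
  apply: (nonresidue_split_eq0 _ 2%:R r) => //.
    apply/eqP; rewrite -subr_eq0; apply/eqP; rewrite r2.
    have := congr1 (intmul (1 : 'F_p)) e0.
    rewrite !(rmorphB, rmorphM, rmorphXn) /= -pmulrn p0 mul0r => <-; ring.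
  apply: (mulfI two_neq0); apply/eqP; rewrite -subr_eq0 -mulrBr; apply/eqP.
  have := congr1 (intmul (1 : 'F_p)) e1.
  by rewrite !(rmorphB, rmorphM) /= -pmulrn p0 mul0r.
have dvd_p (a : int) : a%:~R = 0 :> 'F_p -> exists a', a = p%:Z * a'.
  move=> /eqP; rewrite intr_Fp_eq0 // => /dvdzP[a' ->].
  by exists a'; rewrite mulrC.
have [x0' x0E] := dvd_p _ x00; have [x1' x1E] := dvd_p _ x10.
have [z0' z0E] := dvd_p _ z00; have [z1' z1E] := dvd_p _ z10.
have {}xE : x = p%:R * (x0'%:~R + x1'%:~R * s).
  by rewrite xE x0E x1E !rmorphM /=; ring.
have {}zE : z = p%:R * (z0'%:~R + z1'%:~R * s).
  by rewrite zE z0E z1E !rmorphM /=; ring.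
exists (x0'%:~R + x1'%:~R * s), (z0'%:~R + z1'%:~R * s).
split=> //; [by exists x0', x1' | by exists z0', z1' |].
by apply: (mulfI p_neq0); rewrite -e xE zE; ring.
Qed.

Lemma int_span_anisotropic (p : nat) (r : 'F_p) (x z y t : L) :
  prime p -> odd p -> r != 0 -> r ^+ 2 = - 3%:R ->
  (forall u : 'F_p, u ^+ 2 != 2%:R) ->
  int_span s x -> int_span s z -> int_span s y -> int_span s t ->
  x ^+ 2 - 2%:R * z ^+ 2 = p%:R * (y ^+ 2 - 2%:R * t ^+ 2) ->
  x = 0 /\ z = 0.
Proof.
move=> p_pr p_odd r_neq0 r2 nres Ox Oz Oy Ot e.
have step := int_span_descent_step p r _ _ _ _ p_pr p_odd r_neq0 r2 nres.
have dvd_pow m : exists2 x', int_span s x' & exists2 z', int_span s z' &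
    x = (p ^ m)%:R * x' /\ z = (p ^ m)%:R * z'.
  elim: m x z y t Ox Oz Oy Ot e => [|m IHm] x0 z0 y0 t0 Ox Oz Oy Ot e.
    by exists x0 => //; exists z0 => //; rewrite !mul1r.
  have [x1 [z1 [Ox1 Oz1 -> -> e1]]] := step _ _ _ _ Ox Oz Oy Ot e.
  have [y1 [t1 [Oy1 Ot1 _ _ e2]]] := step _ _ _ _ Oy Ot Ox1 Oz1 e1.
  have [x' Ox' [z' Oz' [-> ->]]] := IHm _ _ _ _ Ox1 Oz1 Oy1 Ot1 e2.
  by exists x' => //; exists z' => //; rewrite !mulrA -natrM -expnS.
by split; apply: (int_span_unbounded_dvd _ _ (prime_gt1 p_pr)) => // m;
  have [x' Ox' [z' Oz' [ex ez]]] := dvd_pow m; [exists x' | exists z'].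
Qed.

(** This is Q(s), presented through denominators so that a zero of the form can be scaled into
    Z[s]. *)
Definition rat_span (x : L) : Prop :=
  exists2 n : int, n != 0 & int_span s (n%:~R * x).

Lemma int_span_rat_span (x : L) : int_span s x -> rat_span x.
Proof. by exists 1; rewrite // mul1r. Qed.

Lemma rat_spanD (x y : L) : rat_span x -> rat_span y -> rat_span (x + y).
Proof.
move=> [m m0 Ox] [n n0 Oy]; exists (m * n); first by rewrite mulf_neq0.
have -> : (m * n)%:~R * (x + y) =
    n%:~R * (m%:~R * x) + m%:~R * (n%:~R * y) by rewrite rmorphM /=; ring.
by apply: int_spanD; apply: int_spanM => //; apply: int_span_int.
Qed.

Lemma rat_spanM (x y : L) : rat_span x -> rat_span y -> rat_span (x * y).
Proof.
move=> [m m0 Ox] [n n0 Oy]; exists (m * n); first by rewrite mulf_neq0.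
have -> : (m * n)%:~R * (x * y) =
    (m%:~R * x) * (n%:~R * y) by rewrite rmorphM /=; ring.
exact: int_spanM.
Qed.

Lemma rat_span_adjoin (eps : L) (x : L) :
  s = 2%:R * eps + 1 -> x \in <<1; eps>>%VS -> rat_span x.
Proof.
move=> sE /Fadjoin_polyP[q /polyOverP q1 ->].
have eps_span : rat_span eps.
  (* Here 2 eps = -1 + s. *)
  by exists 2; rewrite //; exists (- 1), 1; rewrite sE; ring.
rewrite horner_coef.
apply: (big_ind rat_span); [|exact: rat_spanD|].
  by apply: int_span_rat_span; apply: (int_span_int 0).
move=> i _; apply: rat_spanM.
  have /vlineP[k ->] := q1 i.
  exists (denq k); first exact: denq_neq0.
  rewrite -(rmorph_int (in_alg L)) -[k%:A]/(in_alg L k) -rmorphM mulrC.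
  by rewrite -numqE rmorph_int; apply: int_span_int.
elim: (i : nat) => [|n IHn]; last by rewrite exprS; apply: rat_spanM.
by apply: int_span_rat_span; apply: (int_span_int 1).
Qed.

Lemma rat_span_anisotropic (p : nat) (r : 'F_p) (x y z t : L) :
  prime p -> odd p -> r != 0 -> r ^+ 2 = - 3%:R ->
  (forall u : 'F_p, u ^+ 2 != 2%:R) ->
  rat_span x -> rat_span y -> rat_span z -> rat_span t ->
  quat_norm p%:R 2%:R x y z t = 0 -> [/\ x = 0, y = 0, z = 0 & t = 0].
Proof.
move=> p_pr p_odd r_neq0 r2 nres [k k0 Ox] [l l0 Oy] [m m0 Oz] [n n0 Ot] q0.
pose c : L := (k * l * m * n)%:~R.
have c_neq0 : c != 0 by rewrite /c intr_rat_ext_eq0 !mulf_neq0.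
have scale (a b : int) u : int_span s (a%:~R * u) -> c = (a * b)%:~R ->
    int_span s (c * u).
  move=> Ou ->; rewrite rmorphM /= -mulrA mulrCA.
  by apply: int_spanM => //; apply: int_span_int.
have {}Ox : int_span s (c * x).
  by apply: (scale k (l * m * n)) => //; congr _%:~R; ring.
have {}Oy : int_span s (c * y).
  by apply: (scale l (k * m * n)) => //; congr _%:~R; ring.
have {}Oz : int_span s (c * z).
  by apply: (scale m (k * l * n)) => //; congr _%:~R; ring.
have {}Ot : int_span s (c * t).
  by apply: (scale n (k * l * m)) => //; congr _%:~R; ring.
have p_neq0 : p%:R != 0 :> L.
  by rewrite pmulrn intr_rat_ext_eq0 eqz_nat -lt0n prime_gt0.
have e : (c * x) ^+ 2 - 2%:R * (c * z) ^+ 2 =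
         p%:R * ((c * y) ^+ 2 - 2%:R * (c * t) ^+ 2).
  apply/eqP; rewrite -subr_eq0; apply/eqP.
  transitivity (c ^+ 2 * quat_norm p%:R 2%:R x y z t); last by rewrite q0 mulr0.
  by rewrite /quat_norm; ring.
have aniso := int_span_anisotropic p r _ _ _ _ p_pr p_odd r_neq0 r2 nres.
have [cx0 cz0] := aniso _ _ _ _ Ox Oz Oy Ot e.
(* Once c x = c z = 0, the equation also holds with the two pairs exchanged, both sides being
   zero. *)
have [cy0 ct0] : c * y = 0 /\ c * t = 0.
  apply: (aniso _ _ _ _ Oy Ot Ox Oz).
  apply: (mulfI p_neq0); rewrite -e cx0 cz0; ring.
by split; apply: (mulfI c_neq0); rewrite mulr0.
Qed.

Lemma isotropic_of_residue (S : {pred L}) (p : nat) (r : 'F_p) :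
  prime p -> r ^+ 2 = - 6%:R -> (forall a b : int, a%:~R + b%:~R * s \in S) ->
  ~ anisotropic S p%:R 2%:R.
Proof.
move=> p_pr r2 S_span aniso.
have [x [y [k [xy0 x_lt y_lt e]]]] := thue_form p r (- 6) p_pr r2.
have [u [v [Su Sv uv]]] : exists u v : L, [/\ u \in S, v \in S &
    u ^+ 2 - 2%:R * v ^+ 2 = k%:~R].
  (* For u = a + b s and v = c + d s, the first hypothesis fixes the rational part of u^2 - 2 v^2,
     and the second cancels its coefficient of s. *)
  have norm (a b c d : int) :
      a ^+ 2 - 3 * b ^+ 2 - 2 * (c ^+ 2 - 3 * d ^+ 2) = k ->
      a * b = 2 * (c * d) -> exists u v : L, [/\ u \in S, v \in S &
      u ^+ 2 - 2%:R * v ^+ 2 = k%:~R].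
    move=> <- ab; exists (a%:~R + b%:~R * s), (c%:~R + d%:~R * s); split=> //.
    have {}ab : a%:~R * b%:~R = 2%:R * (c%:~R * d%:~R) :> L.
      by have := congr1 (intmul (1 : L)) ab; rewrite !rmorphM.
    rewrite !(rmorphB, rmorphM, rmorphXn) /=.
    transitivity (a%:~R ^+ 2 + b%:~R ^+ 2 * s ^+ 2 + 2%:R * s * (a%:~R * b%:~R)
      - 2%:R * (c%:~R ^+ 2 + d%:~R ^+ 2 * s ^+ 2 + 2%:R * s * (c%:~R * d%:~R)));
      first by ring.
    by rewrite s2 ab; ring.
  (* Both squares are below p, so 0 < x^2 + 6 y^2 < 7p. *)
  have [k1|[k2|[k3|[k4|[k5|k6]]]]] :
      k = 1 \/ k = 2 \/ k = 3 \/ k = 4 \/ k = 5 \/ k = 6.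
    have x_ge0 := sqr_ge0 x; have y_ge0 := sqr_ge0 y.
    have xy_gt0 : 0 < x ^+ 2 + 6 * y ^+ 2.
      by have := sqrf_eq0 x; have := sqrf_eq0 y; lia.
    have p_gt0 : 0 < p%:Z by rewrite ltz_nat prime_gt0.
    have k_gt0 : 0 < k by rewrite -(pmulr_lgt0 _ p_gt0); lia.
    have k_lt7 : k < 7 by rewrite -(ltr_pM2r p_gt0); lia.
    by lia.
  - exact: (norm 1 0 0 0).
  - exact: (norm 2 0 1 0).
  - exact: (norm 0 1 0 1).
  - exact: (norm 2 0 0 0).
  - exact: (norm 2 (- 1) (- 1) 1).
  - exact: (norm 0 4 0 3).
have s_neq0 : s != 0.
  by rewrite -sqrf_eq0 s2 oppr_eq0 pmulrn intr_rat_ext_eq0.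
(* Since s^2 = -3, x^2 - 2 (y s)^2 = x^2 + 6 y^2 = k p = p (u^2 - 2 v^2). *)
have [||||| x0 _ y0 _] := aniso x%:~R u (y%:~R * s) v => //.
- by have := S_span x 0; rewrite mul0r addr0.
- by have := S_span 0 y; rewrite add0r.
- transitivity (x%:~R ^+ 2 - 2%:R * (y%:~R ^+ 2 * s ^+ 2)
    - p%:R * (u ^+ 2 - 2%:R * v ^+ 2)); first by rewrite /quat_norm; ring.
  rewrite s2 uv; have := congr1 (intmul (1 : L)) e.
  rewrite !(rmorphB, rmorphM, rmorphXn) /= -pmulrn => {}e.
  by apply/eqP; rewrite subr_eq0 (mulrC p%:R) -e; apply/eqP; ring.
move/eqP: x0; rewrite intr_rat_ext_eq0 => /eqP x0.
move/eqP: y0; rewrite mulf_eq0 (negPf s_neq0) orbF intr_rat_ext_eq0 => /eqP y0.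
by rewrite x0 y0 eqxx in xy0.
Qed.

End SqrtMinusThree.

(** * The Legendre symbol of -3 and the equivalence *)

Lemma legendre_eq1P (m : int) (p : nat) : prime p ->
  legendre m p = 1 <-> exists2 r : 'F_p, r != 0 & r ^+ 2 = m%:~R.
Proof.
move=> p_pr; rewrite /legendre -intr_Fp_eq0 //; split.
  case: eqP => // m_neq0; case: existsP => // -[x].
  rewrite eqz_mod_dvd -intr_Fp_eq0 // rmorphB rmorphXn subr_eq0 => /eqP xm _.
  exists (x%:Z%:~R) => //; apply: contra_notN m_neq0 => /eqP x0.
  by rewrite -xm /= x0 expr0n.
move=> [r r_neq0 r2].
rewrite -r2 expf_eq0 (negPf r_neq0) andbF; case: existsP => // -[].
have lt_rp : (r < p)%N by have := ltn_ord r; rewrite {2}(Fp_cast p_pr).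
exists (Ordinal lt_rp); rewrite eqz_mod_dvd -intr_Fp_eq0 // rmorphB rmorphXn.
by rewrite subr_eq0 /= -r2 -pmulrn natr_Zp.
Qed.

(** Either p = 3 and -6 vanishes modulo p, or -3 and 2 are both nonresidues and their product is a
    square. *)
Lemma residue_of_legendre_neq1 (p : nat) : prime p -> p = 3 %[mod 8] ->
  legendre (- 3) p <> 1 -> exists r : 'F_p, r ^+ 2 = - 6%:R.
Proof.
move=> p_pr p3 leg_neq1.
have [m3_0|m3_neq0] := eqVneq (- 3%:R : 'F_p) 0.
  exists 0; rewrite expr0n /= -[6%N]/(2 * 3)%N natrM -mulrN m3_0 mulr0 //.
have [||r rE] := mul_nonresidues p (- 3%:R) 2%:R p_pr; first 1 last.
- by move=> r; apply: two_nonresidue.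
- by exists r; rewrite rE; ring.
move=> r; apply: contra_notN leg_neq1 => /eqP r2.
apply/legendre_eq1P => //; exists r; last by rewrite r2; ring.
by apply: contraNneq m3_neq0 => r0; rewrite -r2 r0 expr0n.
Qed.

Theorem proposition6p3 (L : fieldExtType rat) (eps theta : L)
    (alpha : int) (p : nat)
    (eps_prim : 3.-primitive_root eps)
    (alpha_neq0 : alpha != 0) (alpha_neq1 : alpha != 1)
    (alpha_cubefree : cubefree alpha)
    (theta_root : theta ^+ 3 = alpha%:~R)
    (p_prime : prime p) (p_odd : odd p) (p_mod8 : p = 3 %[mod 8]) :
  let F : {subfield L} := <<1; eps>>%AS in
  let K : {subfield L} := <<F; theta>>%AS in
  is_division_algebra (quaternion (p%:R : subvs_of K) 2%:R)
  <-> legendre (- 3) p = 1.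
Proof.
move=> F K.
pose s : L := 2%:R * eps + 1.
have s2 : s ^+ 2 = - 3%:R.
  have eps_neq1 : eps - 1 != 0.
    by rewrite subr_eq0 -[eps]expr1 -(prim_order_dvd eps_prim).
  apply: (mulfI eps_neq1).
  (* This is s^2 + 3 = 4 (eps^2 + eps + 1) multiplied by eps - 1. *)
  transitivity (4%:R * (eps ^+ 3 - 1) - 3%:R * (eps - 1)).
    by rewrite /s; ring.
  by rewrite (prim_expr_order eps_prim); ring.
have F_eps : eps \in F by apply: memv_adjoin.
have F_K : {subset F <= K} by apply/subvP/subv_adjoin.
have F_s (a b : int) : a%:~R + b%:~R * s \in F.
  by rewrite !(rpredD, rpredM) ?rpred_int ?rpred_nat ?rpred1.
rewrite division_quaternionP anisotropic_subvs !rmorph_nat; split.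
  move=> aniso; have [//|/eqP leg_neq1] := eqVneq (legendre (- 3) p) 1.
  have [r r2] := residue_of_legendre_neq1 p p_prime p_mod8 leg_neq1.
  have K_s (a b : int) : a%:~R + b%:~R * s \in K by apply: F_K.
  by have := isotropic_of_residue _ s s2 _ p r p_prime r2 K_s aniso.
move=> /(legendre_eq1P _ _ p_prime)[r r_neq0 r2].
have anisoF : anisotropic F (p%:R : L) 2%:R.
  move=> x y z t Fx Fy Fz Ft.
  apply: (rat_span_anisotropic _ s s2 p r) => //.
    by move=> u; apply: two_nonresidue.
  1-4: exact: (rat_span_adjoin _ s s2 eps _ erefl).
(* The extension may be trivial, as for alpha = -1; then K = F. *)
have [F_theta|nF_theta] := boolP (theta \in F).
  suff KF : {subset K <= F}.
    by move=> x y z t /KF Fx /KF Fy /KF Fz /KF Ft; apply: anisoF.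
  by apply/subvP/FadjoinP.
have F_theta3 : theta ^+ 3 \in F by rewrite theta_root rpred_int.
rewrite -!(rmorph_nat (vsval : subvs_of F -> L)).
apply: anisotropic_adjoin_cube_root => //; last by rewrite !rmorph_nat.
(* Two cube roots of alpha differ by a power of eps, so a cube root in F would put theta in F. *)
move=> u Fu; apply: contra nF_theta => /eqP u3.
have theta_neq0 : theta != 0.
  by rewrite -[_ == _](expf_eq0 theta 3) theta_root intr_rat_ext_eq0.
have u_neq0 : u != 0 by rewrite -[_ == _](expf_eq0 u 3) u3 expf_eq0.
have /(prim_rootP eps_prim)[i theta_u] : (theta / u) ^+ 3 = 1.
  by rewrite expr_div_n -u3 divff // expf_neq0.
by rewrite -(divfK u_neq0 theta) theta_u rpredM ?rpredX.
Qed.
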